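(* Let $p$ be a prime, $e\ge 1$, $N = p^e$, and $k \ge 1$. Fix an integer $n > \pi_N(k)$ and let $\mathcal{S} = (s_0, s_1, \ldots, s_{\pi_N(k)-1})$ where $s_\alpha \in \mathbb{Z}/N\mathbb{Z}$ is the residue of $[q^\alpha]\begin{bmatrix} n+k \\ k \end{bmatrix}_q$ modulo $N$. Then $s_{\pi_N(k)-1}, s_{\pi_N(k)-2}, \ldots, s_{\pi_N(k)-\binom{k+1}{2}+1}$ are all $0$ modulo $N$, and \[ s_i = (-1)^{k+1} s_{\pi_N(k)-\binom{k+1}{2}-i} \] for all $0 \le i \le \pi_N(k) - \binom{k+1}{2}$.
   Context: The Gaussian polynomial is $\begin{bmatrix} n \\ k \end{bmatrix}_q = \frac{[n]!}{[n-k]!\,[k]!}$ with $[m]! = \prod_{i=1}^{m} \frac{1-q^i}{1-q}$; $[q^\alpha]f$ is the coefficient of $q^\alpha$ in $f$. $p_{\le k}(n)$ denotes the number of partitions of $n$ with at most $k$ parts. For a modulus $M$, the sequence $(p_{\le k}(n) \bmod M)_{n \ge 0}$ is purely periodic, and $\pi_M(k)$ denotes its minimal period. *)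

(* Defs.v *)
From HB Require Import structures.
From mathcomp Require Import all_boot all_order all_algebra.
From mathcomp Require Import boolp classical_sets.

Set Implicit Arguments.
Unset Strict Implicit.
Unset Printing Implicit Defensive.

Import GRing.Theory.
Local Open Scope ring_scope.

(* Polynomials are over int: %/ is Euclidean division whenever the leading   *)
(* coefficient of the divisor is a unit, which is the case (it is 1 or -1)    *)
(* for every divisor below; these divisions are all exact.                    *)
Definition qfact (m : nat) : {poly int} :=
  \prod_(1 <= i < m.+1) ((1 - 'X^i) %/ (1 - 'X)).

Definition gaussian (n k : nat) : {poly int} :=
  qfact n %/ (qfact (n - k) * qfact k).

Definition is_partition (n : nat) (s : seq nat) : bool :=
  [&& sorted geq s, 0%N \notin s & sumn s == n].

(* {bseq k of T} is the type of sequences of length at most k; bounding the   *)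
(* parts by n excludes no partition of n.                                     *)
Definition num_partitions_le (k n : nat) : nat :=
  #|[pred s : {bseq k of 'I_n.+1} | is_partition n [seq val x | x <- s]]|.

Definition is_period_mod (M : nat) (u : nat -> nat) (T : nat) : Prop :=
  (0 < T)%N /\ forall n, u (n + T)%N = u n %[mod M].

Definition is_min_period_mod (M : nat) (u : nat -> nat) (T : nat) : Prop :=
  is_period_mod M u T /\ forall T', is_period_mod M u T' -> (T <= T')%N.

(* The default value 0 of xget is irrelevant for 0 < M, where the sequence is *)
(* purely periodic mod M.                                                     *)
Definition min_period (M k : nat) : nat :=
  xget 0%N [set T | is_min_period_mod M (num_partitions_le k) T]%classic.

(* Main.v *)
(* Let D = (1 - q)...(1 - q^k) and let F be the generating function of
   p_{<=k}, so that D F = 1.  Since D [n+k choose k]_q = 1 modulo q^(n+1), the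
   coefficients of the Gaussian polynomial up to q^n are those of F.  A number
   T is a period of F modulo N exactly when 1 - q^T = D A modulo N, where A is
   then F truncated at q^T.  Comparing degrees, A has degree T - binom(k+1, 2),
   whence the vanishing coefficients; reversing the coefficients in
   1 - q^T = D A negates the left side and multiplies D by (-1)^k, whence the
   symmetry of A. *)
Require Import Defs.
From HB Require Import structures.
From mathcomp Require Import all_boot all_order all_algebra.
From mathcomp Require Import ring zify.
From mathcomp Require Import boolp classical_sets.

Set Implicit Arguments.
Unset Strict Implicit.
Unset Printing Implicit Defensive.

Import GRing.Theory.
Local Open Scope ring_scope.

(** * Partitions with at most [k] parts: enumeration and recurrence *)

Definition partitions (k n : nat) : seq (seq nat) :=
  [seq [seq val x | x <- s]
     | s : {bseq k of 'I_n.+1} in [pred s | is_partition n [seq val x | x <- val s]]].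

Lemma size_partitions k n : size (partitions k n) = num_partitions_le k n.
Proof. by rewrite size_image. Qed.

Lemma partitions_uniq k n : uniq (partitions k n).
Proof.
rewrite map_inj_uniq ?enum_uniq // => s t /(inj_map val_inj) /val_inj //.
Qed.

Lemma leq_sumn x (s : seq nat) : x \in s -> (x <= sumn s)%N.
Proof. by move=> xs; rewrite (perm_sumn (perm_to_rem xs)) leq_addr. Qed.

Lemma mem_partitions k n (s : seq nat) :
  (s \in partitions k n) = is_partition n s && (size s <= k)%N.
Proof.
rewrite /partitions; apply/mapP/andP => [[t]|[s_part sk]].
  by rewrite mem_enum => t_part ->; rewrite size_map size_bseq; split.
have s_lt : all (fun x => x < n.+1)%N s.
  apply/allP => x /leq_sumn; case/and3P: s_part => _ _ /eqP ->.
  by rewrite ltnS.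
have szt : (size [seq (inord x : 'I_n.+1) | x <- s] <= k)%N by rewrite size_map.
have valt : [seq val x | x <- [seq (inord x : 'I_n.+1) | x <- s]] = s.
  rewrite -map_comp -[RHS]map_id; apply/eq_in_map => x /(allP s_lt) xn /=.
  by rewrite inordK.
by exists (Bseq szt); rewrite ?mem_enum ?inE /= valt.
Qed.

Lemma num_partitions_le0 n : num_partitions_le 0 n = (n == 0)%N.
Proof.
rewrite -size_partitions; have := @mem_partitions 0 n.
have := partitions_uniq 0 n; case: n => [|n] us mems.
  have/perm_size -> // : perm_eq (partitions 0 0) [:: [::]].
  apply: uniq_perm => // s; rewrite mems inE.
  by case: s => [|x s] //=; rewrite andbF.
case: (partitions _ _) mems => // s l /(_ s).
by rewrite mem_head; case: s => // x s; rewrite andbF.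
Qed.

Lemma sorted_geq_filter0 (s : seq nat) : sorted geq s ->
  s = [seq x <- s | x != 0%N] ++ nseq (size s - size [seq x <- s | x != 0%N]) 0%N.
Proof.
elim: s => //= x s IHs xs; have /IHs := path_sorted xs.
case: x xs => [|x] xs /=; last by rewrite subSS => {1}->.
(* A leading 0 in a weakly decreasing sequence forces all later entries to be 0. *)
have /all_pred1P -> : all (pred1 0%N) s.
  move: xs; rewrite path_sortedE; last by move=> a b c /=; lia.
  by case/andP => /allP s0 _; apply/allP => y /s0 /=; lia.
move=> _.
by rewrite filter_nseq /= size_nseq.
Qed.

(** The bijection from partitions with at most [k] parts to partitions with exactly [k] parts, which
    adds [k] to the sum. *)
Definition succ_parts (k : nat) (s : seq nat) : seq nat :=
  [seq x.+1 | x <- s ++ nseq (k - size s) 0%N].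

Lemma succ_partsK k (s : seq nat) : 0%N \notin s ->
  [seq x <- [seq x.-1 | x <- succ_parts k s] | x != 0%N] = s.
Proof.
move=> s0; rewrite -map_comp map_id_in // filter_cat filter_nseq /= cats0.
by apply/all_filterP/allP => x; apply: contraTneq => ->.
Qed.

Lemma sumn_map_succ (s : seq nat) : sumn [seq x.+1 | x <- s] = (sumn s + size s)%N.
Proof. by elim: s => //= x s ->; lia. Qed.

(** A preimage of [t] is found by lowering every part by 1 and dropping the zeros; these form a
    suffix because [t] is decreasing, so padding restores them. *)
Lemma mem_succ_parts k n (t : seq nat) : (k <= n)%N ->
  (t \in [seq succ_parts k s | s <- partitions k (n - k)])
  = is_partition n t && (size t == k).
Proof.
move=> kn; apply/mapP/andP => [[s]|[]].
  rewrite mem_partitions => /andP[/and3P[srt s0 /eqP sn] sk] ->.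
  have szs : size (s ++ nseq (k - size s) 0%N) = k.
    by rewrite size_cat size_nseq subnKC.
  split; last by rewrite size_map szs.
  apply/and3P; split.
  - rewrite sorted_map sorted_pairwise; last by move=> a b c /=; lia.
    rewrite pairwise_cat; apply/and3P; split.
    + by apply/allrelP => x y _ /nseqP[-> _].
    + by move: srt; rewrite sorted_pairwise // => a b c /=; lia.
    + by elim: (k - _)%N => //= m ->; rewrite all_nseq orbT.
  - by apply/mapP => -[].
  - by rewrite sumn_map_succ szs sumn_cat sumn_nseq mul0n addn0 sn subnK.
case/and3P => srt t0 /eqP tn /eqP tk.
have tE : [seq x.+1 | x <- [seq x.-1 | x <- t]] = t.
  rewrite -map_comp map_id_in // => x xt /=; rewrite prednK // lt0n.
  by apply: contraNneq t0 => <-.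
have srt' : sorted geq [seq x.-1 | x <- t].
  apply: homo_sorted srt => a b /=; lia.
have E := sorted_geq_filter0 srt'.
set s := [seq x <- _ | _] in E; rewrite size_map tk in E.
have sumE : (sumn s + k = n)%N.
  by rewrite -tn -tE sumn_map_succ size_map tk E sumn_cat sumn_nseq mul0n addn0.
exists s; last by rewrite /succ_parts -E tE.
rewrite mem_partitions /is_partition sorted_filter //=; last by move=> a b c /=; lia.
rewrite mem_filter /=; apply/andP; split; first by apply/eqP; lia.
by rewrite -tk -(size_map predn t) size_filter count_size.
Qed.

(** Either there are at most [k] parts, or exactly [k.+1] and [succ_parts] applies. The factor
    [(k < n)] guards the truncated subtraction: parts are positive, so [k.+1] of them sum to more
    than [k]. *)
Lemma num_partitions_leS k n : num_partitions_le k.+1 n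
  = (num_partitions_le k n + (k < n) * num_partitions_le k.+1 (n - k.+1))%N.
Proof.
rewrite -!size_partitions; case: ltnP => [kn|nk]; last first.
  rewrite mul0n addn0; apply/perm_size/uniq_perm; rewrite ?partitions_uniq //.
  move=> s; rewrite !mem_partitions; case: (boolP (is_partition n s)) => //=.
  case/and3P => _ s0 /eqP sn.
  have : (size s <= sumn s)%N.
    elim: s s0 {sn} => //= x s IHs; rewrite inE negb_or eq_sym -lt0n.
    by case/andP => x0 /IHs; lia.
  by rewrite sn => sn_le; rewrite !(leq_trans sn_le) // leqW.
rewrite mul1n -(size_map (succ_parts k.+1) (partitions _ (_ - _))) -size_cat.
apply/perm_size/uniq_perm; rewrite ?partitions_uniq //.
  rewrite cat_uniq partitions_uniq /= map_inj_in_uniq ?partitions_uniq ?andbT.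
    apply/hasPn => s; rewrite mem_succ_parts // mem_partitions => /andP[_ /eqP ->].
    by rewrite ltnn andbF.
  move=> s t; rewrite !mem_partitions => /andP[/and3P[_ s0 _] _] /andP[/and3P[_ t0 _] _].
  by move=> st; rewrite -(succ_partsK k.+1 s0) st succ_partsK.
move=> s; rewrite mem_cat mem_succ_parts // !mem_partitions -andb_orr.
by rewrite orbC leq_eqVlt ltnS.
Qed.

(** * Power series, handled as polynomials modulo [X^n] *)

Definition eqX (R : nzRingType) (n : nat) (p q : {poly R}) : Prop :=
  forall i, (i < n)%N -> p`_i = q`_i.

Lemma eqX_mull (R : nzRingType) n (r p q : {poly R}) :
  eqX n p q -> eqX n (r * p) (r * q).
Proof.
move=> pq i lt_in; rewrite !coefM; apply: eq_bigr => j _.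
by rewrite pq // (leq_ltn_trans (leq_subr _ _)).
Qed.

Lemma eqX_poly (R : nzRingType) (p q : {poly R}) : (forall n, eqX n p q) -> p = q.
Proof. by move=> pq; apply/polyP => i; apply: (pq i.+1). Qed.

Definition qpoch (R : comNzRingType) (k : nat) : {poly R} :=
  \prod_(i < k) (1 - 'X^(i.+1)).

Lemma qpochS (R : comNzRingType) k : qpoch R k.+1 = qpoch R k * (1 - 'X^(k.+1)).
Proof. exact: big_ord_recr. Qed.

(** Monicity up to sign makes degrees add in products with [qpoch R k], even when [R] has zero
    divisors, as ['Z_N] may. *)
Lemma monic_qpoch (R : comNzRingType) k : (-1) ^+ k * qpoch R k \is monic.
Proof.
elim: k => [|k IHk]; first by rewrite /qpoch big_ord0 mulr1 monic1.
have -> : (-1) ^+ k.+1 * qpoch R k.+1 = (-1) ^+ k * qpoch R k * ('X^(k.+1) - 1).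
  by rewrite qpochS exprS; ring.
by rewrite monicMl // monicXnsubC.
Qed.

Lemma size_qpoch (R : comNzRingType) k : size (qpoch R k) = 'C(k.+1, 2).+1.
Proof.
elim: k => [|k IHk]; first by rewrite /qpoch big_ord0 size_poly1.
rewrite qpochS -opprB mulrN size_polyN size_Mmonic ?monicXnsubC //; last first.
  by rewrite -size_poly_gt0 IHk.
by rewrite IHk size_XnsubC // [in RHS]binS bin1; lia.
Qed.

Lemma size_qpoch_mul (R : comNzRingType) k (p : {poly R}) : p != 0 ->
  size (qpoch R k * p) = (size p + 'C(k.+1, 2))%N.
Proof.
move=> p0; rewrite -(size_Msign _ k) mulrA mulrC size_Mmonic ?monic_qpoch //.
by rewrite size_Msign size_qpoch addnS.
Qed.

Definition pgf (R : comNzRingType) (k n : nat) : {poly R} :=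
  \poly_(i < n) (num_partitions_le k i)%:R.

(** By the recurrence, multiplying [pgf R k.+1 n] by [1 - X^(k+1)] gives [pgf R k n] modulo
    [X^n]. *)
Lemma qpoch_pgf (R : comNzRingType) k n : eqX n (qpoch R k * pgf R k n) 1.
Proof.
elim: k => [|k IHk] i lt_in.
  by rewrite /qpoch big_ord0 mul1r coef_poly lt_in num_partitions_le0 coef1.
rewrite qpochS -mulrA -[RHS](IHk i lt_in); apply: (@eqX_mull _ n) => // {lt_in}i lt_in.
rewrite mulrBl mul1r coefB coefXnM !coef_poly lt_in num_partitions_leS ltnS.
case: leqP => [ik|ki]; first by rewrite mul0n addn0 subr0.
by rewrite (leq_ltn_trans (leq_subr _ _) lt_in) mul1n natrD addrK.
Qed.

(** [pgf R k n] is an inverse of [qpoch R k] modulo [X^n]. *)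
Lemma qpoch_cancel (R : comNzRingType) k n (p q : {poly R}) :
  eqX n (qpoch R k * p) (qpoch R k * q) -> eqX n p q.
Proof.
have inv r : eqX n (pgf R k n * (qpoch R k * r)) r.
  by move=> i lt_in; rewrite mulrC mulrAC mulrC (eqX_mull _ (@qpoch_pgf _ _ _)) ?mulr1.
by move=> pq i lt_in; rewrite -inv // (eqX_mull _ pq) // inv.
Qed.

Lemma qpoch_inj (R : comNzRingType) k : injective (fun p => qpoch R k * p).
Proof.
by move=> p q pq; apply: eqX_poly => n; apply: (@qpoch_cancel _ k) => i _; rewrite pq.
Qed.

Lemma qpoch_addn (R : comNzRingType) n k : eqX n.+1 (qpoch R (n + k)) (qpoch R n).
Proof.
elim: k => [|k IHk] i lt_in; first by rewrite addn0.
rewrite addnS qpochS mulrBr mulr1 coefB coefMXn IHk //.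
by rewrite (leq_trans lt_in) ?ltnS ?leq_addr // subr0.
Qed.

(** * Gaussian polynomials and their low coefficients *)

Definition qint (m : nat) : {poly int} := \sum_(i < m) 'X^i.

Lemma mul_qint m : (1 - 'X) * qint m = 1 - 'X^m.
Proof. by rewrite -opprB mulNr -subrX1 opprB. Qed.

Lemma monic_qint m : qint m.+1 \is monic.
Proof.
by rewrite -(monicMl _ (monicXsubC 1)) -subrX1 monicXnsubC.
Qed.

Lemma qfactE m : qfact m = \prod_(i < m) qint i.+1.
Proof.
rewrite /qfact big_add1 big_mkord; apply: eq_bigr => i _.
by rewrite -mul_qint Pdiv.IdomainUnit.mulKp // -opprB lead_coefN lead_coefXsubC.
Qed.

Lemma qfactS m : qfact m.+1 = qfact m * qint m.+1.
Proof. by rewrite !qfactE big_ord_recr. Qed.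

Lemma monic_qfact m : qfact m \is monic.
Proof. by rewrite qfactE monic_prod // => i _; apply: monic_qint. Qed.

Lemma qfact_qpoch m : (1 - 'X) ^+ m * qfact m = qpoch int m.
Proof.
elim: m => [|m IHm]; first by rewrite qfactE /qpoch !big_ord0 mulr1.
by rewrite qfactS qpochS -IHm exprS -mul_qint; ring.
Qed.

(* q-Pascal, via [n+k+2] = [n+1] + q^(n+1) [k+1]. *)
Lemma qfact_dvd n k : exists G, qfact (n + k) = G * (qfact n * qfact k).
Proof.
elim: n k => [|n IHn] k.
  by exists 1; rewrite (qfactE 0) big_ord0 !mul1r.
elim: k => [|k [G2 IH2]].
  by exists 1; rewrite (qfactE 0) big_ord0 addn0 mulr1 mul1r.
have [G1 IH1] := IHn k.+1.
have qintD : qint (n.+1 + k.+1) = qint n.+1 + 'X^(n.+1) * qint k.+1.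
  rewrite /qint big_split_ord /= mulr_sumr; congr (_ + _).
  by apply: eq_bigr => i _; rewrite exprD.
exists (G1 + 'X^(n.+1) * G2).
rewrite addnS qfactS -addnS qintD mulrDr {1}addSnnS IH1 IH2 !qfactS.
by rewrite !mulrA; ring.
Qed.

Lemma gaussian_qfact n k : gaussian (n + k) k * (qfact n * qfact k) = qfact (n + k).
Proof.
have [G GE] := qfact_dvd n k.
by rewrite /gaussian addnK GE Pdiv.IdomainMonic.mulpK // monicMl monic_qfact.
Qed.

(** The product of the Gaussian polynomial with [qpoch R n * qpoch R k] is [qpoch R (n + k)], which
    is [qpoch R n] modulo [X^(n+1)]; cancelling [qpoch R n], then [qpoch R k], leaves [pgf]. *)
Lemma coef_gaussian (R : comNzRingType) n k i : (i <= n)%N ->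
  ((gaussian (n + k) k)`_i)%:~R = (num_partitions_le k i)%:R :> R.
Proof.
move=> le_in; pose f := map_poly (intr : int -> R).
have fqpoch m : f (qpoch int m) = qpoch R m.
  rewrite /f /qpoch rmorph_prod; apply: eq_bigr => j _.
  by rewrite rmorphB rmorph1 /= map_polyXn.
have GE : qpoch R n * (qpoch R k * f (gaussian (n + k) k)) = qpoch R (n + k).
  rewrite -!fqpoch -!rmorphM -!qfact_qpoch -gaussian_qfact exprD.
  by congr (f _); ring.
have : eqX n.+1 (f (gaussian (n + k) k)) (pgf R k n.+1).
  apply: (@qpoch_cancel _ k) => j lt_jn; rewrite qpoch_pgf //; move: j lt_jn.
  apply: (@qpoch_cancel _ n) => j lt_jn; rewrite GE mulr1; exact: qpoch_addn.
by move=> /(_ i le_in); rewrite coef_map coef_poly ltnS le_in.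
Qed.

(** * Periods and multiples of [qpoch R k] of the form [1 - X^T] *)

Lemma period_qpoch (R : comNzRingType) k T : (0 < T)%N ->
  (forall n, (num_partitions_le k (n + T))%:R = (num_partitions_le k n)%:R :> R) ->
  qpoch R k * pgf R k T = 1 - 'X^T.
Proof.
move=> T0 perT; apply: eqX_poly => n.
have eqF : eqX n (pgf R k T) ((1 - 'X^T) * pgf R k n).
  move=> i lt_in; rewrite mulrBl mul1r coefB coefXnM !coef_poly lt_in.
  case: ltnP => [iT|Ti]; first by rewrite subr0.
  by rewrite (leq_ltn_trans (leq_subr _ _) lt_in) -(perT (i - T)%N) subnK // subrr.
move=> i lt_in; rewrite (eqX_mull _ eqF) // mulrCA.
by rewrite (eqX_mull _ (@qpoch_pgf _ _ _)) // mulr1.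
Qed.

Lemma size_cofactor (R : comNzRingType) k T (F : {poly R}) : (0 < T)%N ->
  qpoch R k * F = 1 - 'X^T ->
  ('C(k.+1, 2) <= T)%N /\ size F = (T - 'C(k.+1, 2)).+1.
Proof.
move=> T0 FE.
have szT : size (1 - 'X^T : {poly R}) = T.+1 by rewrite -opprB size_polyN size_XnsubC.
have F0 : F != 0.
  by apply: contra_eq_neq FE => ->; rewrite mulr0 eq_sym -size_poly_gt0 szT.
have := size_qpoch_mul k F0; rewrite FE szT; move: F0; rewrite -size_poly_gt0.
by move: (size F) => m; lia.
Qed.

(** Modulo [X^m], [B] is [1 - X^T] times the generating function. Since [k > 0], [B] has degree
    below [T], so its coefficient at [n + T], a difference of two partition counts, vanishes. *)
Lemma qpoch_period (R : comNzRingType) k T (B : {poly R}) : (0 < k)%N -> (0 < T)%N ->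
  qpoch R k * B = 1 - 'X^T ->
  forall n, (num_partitions_le k (n + T))%:R = (num_partitions_le k n)%:R :> R.
Proof.
move=> k0 T0 BE n; pose m := (n + T).+1.
have szB : (size B <= T)%N.
  have [leT ->] := size_cofactor T0 BE.
  by rewrite ltn_subrL bin_gt0 ltnS k0.
have : eqX m ((1 - 'X^T) * pgf R k m) B.
  by move=> i lt_im; rewrite -BE mulrAC mulrC (eqX_mull _ (@qpoch_pgf _ _ _)) ?mulr1.
move=> /(_ _ (ltnSn _)); rewrite mulrBl mul1r coefB coefXnM !coef_poly ltnSn.
rewrite ltnNge leq_addl /= addnK ltnS leq_addr nth_default; last first.
  by rewrite (leq_trans szB) ?leq_addl.
by move/eqP; rewrite subr_eq0 => /eqP.
Qed.

(** Provides a period. In the induction, [qpoch R k] and [1 - X^(k+1)] each divide [1 - X^S] with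
    [S = T * k.+1], so their product divides its square, which divides [1 - X^(S * N)] as [N] is 0
    in [R]. *)
Lemma qpoch_dvd (R : comNzRingType) N k : (0 < N)%N -> N%:R = 0 :> R ->
  exists T, (0 < T)%N /\ exists B : {poly R}, qpoch R k * B = 1 - 'X^T.
Proof.
move=> N0 NR0; elim: k => [|k [T [T0 [B BE]]]].
  by exists 1%N; split=> //; exists (1 - 'X); rewrite /qpoch big_ord0 mul1r.
pose S := (T * k.+1)%N; exists (S * N)%N; split; first by rewrite !muln_gt0 T0.
have dvdX d m : exists C : {poly R}, 1 - 'X^(d * m) = (1 - 'X^d) * C.
  exists (\sum_(i < m) 'X^d ^+ i).
  by rewrite -[1 - 'X^d]opprB mulNr -subrX1 opprB exprM.
have [C1 C1E] := dvdX T k.+1; have [C2 C2E] := dvdX k.+1 T.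
(* The cofactor 1 + y + ... + y^(N-1) of 1 - y in 1 - y^N is congruent to
   N = 0 modulo 1 - y, so that (1 - y)^2 divides 1 - y^N. *)
have [K KE] : exists K : {poly R}, 1 - 'X^(S * N) = (1 - 'X^S) * ((1 - 'X^S) * K).
  exists (- \sum_(i < N) \sum_(j < i) 'X^S ^+ j).
  have -> : (1 - 'X^S) * - (\sum_(i < N) \sum_(j < i) 'X^S ^+ j)
            = \sum_(i < N) 'X^S ^+ i :> {poly R}.
    rewrite mulrN -mulNr opprB mulr_sumr.
    under eq_bigr => i _ do rewrite -subrX1.
    rewrite sumrB sumr_const card_ord.
    by rewrite -polyC_natr NR0 subr0.
  by rewrite -[1 - 'X^S]opprB mulNr -subrX1 opprB exprM.
exists (B * C1 * C2 * K).
(* One copy of [u = 1 - X^S] absorbs [q = qpoch R k], the other [v = 1 - X^(k+1)]. *)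
have comb (u q v : {poly R}) :
    u = q * B * C1 -> u = v * C2 -> q * v * (B * C1 * C2 * K) = u * (u * K).
  by move=> E1 E2; rewrite {1}E1 E2; ring.
rewrite KE qpochS; apply: comb; first by rewrite BE -C1E.
by rewrite -C2E /S mulnC.
Qed.

(** * Reversal of coefficients, [X^d p(1/X)] *)

Definition revp (R : nzRingType) (d : nat) (p : {poly R}) : {poly R} :=
  \poly_(i < d.+1) p`_(d - i).

Lemma coef_revp (R : nzRingType) d (p : {poly R}) i :
  (revp d p)`_i = if (i <= d)%N then p`_(d - i) else 0.
Proof. by rewrite coef_poly ltnS. Qed.

Lemma revp_mul1subX (R : nzRingType) d m (p : {poly R}) : (size p <= d.+1)%N ->
  revp (d + m) ((1 - 'X^m) * p) = - ((1 - 'X^m) * revp d p).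
Proof.
move=> szp; apply/polyP => i; rewrite coefN !mulrBl !mul1r !coefB !coefXnM !coef_revp.
rewrite coefB coefXnM opprB.
have [le_idm|lt_dmi] := leqP i (d + m); last first.
  by rewrite !ifF ?subr0 //; lia.
have [lt_im|le_mi] := ltnP i m.
  (* For [i < m] the index [d + m - i] exceeds [d], beyond the coefficients of [p]. *)
  rewrite sub0r [X in X - _]nth_default; last by apply: leq_trans szp _; lia.
  rewrite sub0r; have [le_id|lt_di] := leqP i d.
    by rewrite ifN; [congr (- p`__); lia|lia].
  by rewrite ifT //; lia.
have -> : (i - m <= d)%N by lia.
rewrite [X in X - _](_ : _ = p`_(d - (i - m))); last by congr p`__; lia.
congr (_ - _); have [le_id|lt_di] := leqP i d.
  by rewrite ifN; [congr p`__; lia|lia].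
by rewrite ifT //; lia.
Qed.

Lemma revp_qpoch (R : comNzRingType) d k (p : {poly R}) : (size p <= d.+1)%N ->
  revp (d + 'C(k.+1, 2)) (qpoch R k * p) = (-1) ^+ k * (qpoch R k * revp d p).
Proof.
move=> szp; elim: k => [|k IHk].
  by rewrite addn0 /qpoch big_ord0 !mul1r.
have -> : qpoch R k.+1 * p = (1 - 'X^(k.+1)) * (qpoch R k * p).
  by rewrite qpochS; ring.
rewrite binS bin1 addnA revp_mul1subX ?IHk ?qpochS ?exprS; first by ring.
by apply: leq_trans (size_polyMleq _ _) _; rewrite size_qpoch addSn /= addnC -addSn leq_add2r.
Qed.

(** * The minimal period and the symmetry of the coefficients *)

Lemma eq_natr_Zp N a b : (1 < N)%N -> ((a%:R : 'Z_N) == b%:R) = (a == b %[mod N]).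
Proof. by move=> N1; rewrite -val_eqE /= !val_Zp_nat. Qed.

Lemma min_period_is_min N k : (1 < N)%N -> (0 < k)%N ->
  is_min_period_mod N (num_partitions_le k) (min_period N k).
Proof.
move=> N1 k0; rewrite /min_period.
have [T [T0 [B BE]]] := qpoch_dvd k (ltnW N1) (pchar_Zp N1).
have perT : `[< is_period_mod N (num_partitions_le k) T >].
  apply/asboolP; split=> // n; apply/eqP; rewrite -eq_natr_Zp //.
  exact/eqP/(qpoch_period k0 T0 BE).
have exT : exists T, `[< is_period_mod N (num_partitions_le k) T >] by exists T.
case: (ex_minnP exT) => P /asboolP perP minP.
apply: (@xgetPex _ 0%N [set T | is_min_period_mod N (num_partitions_le k) T]%classic).
by exists P; split=> // T' /asboolP; apply: minP.
Qed.

(* Reversal turns [qpoch k * F = 1 - X^T] into [(-1)^k * qpoch k * revp F = - (1 - X^T)]. *)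
Lemma revp_cofactor (R : comNzRingType) k d (F : {poly R}) : (size F <= d.+1)%N ->
  qpoch R k * F = 1 - 'X^(d + 'C(k.+1, 2)) -> revp d F = (-1) ^+ k.+1 * F.
Proof.
move=> szF FE; apply: (@qpoch_inj _ k); rewrite /= mulrCA.
have := @revp_qpoch R d k F szF; rewrite {1}FE.
(* The left side [1 - X^T] is reversed as the product of [1 - X^T] with the constant 1. *)
have := @revp_mul1subX R 0 (d + 'C(k.+1, 2)) 1; rewrite size_poly1 mulr1 add0n => -> //.
have -> : revp 0 1 = 1 :> {poly R}.
  by apply/polyP => i; rewrite coef_revp sub0n !coef1 leqn0; case: eqP.
rewrite mulr1 -FE => /(congr1 ( *%R ((-1) ^+ k))).
by rewrite mulrA -expr2 sqrr_sign mul1r => <-; rewrite exprS; ring.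
Qed.

Theorem theorem2p6 (p e k n : nat) (p_prime : prime p) (e_ge1 : (1 <= e)%N)
    (k_ge1 : (1 <= k)%N) (n_gt : (min_period (p ^ e) k < n)%N) :
  let N := (p ^ e)%N in
  let P := min_period N k in
  let s (a : nat) : 'Z_N := ((gaussian (n + k) k)`_a)%:~R in
  (forall j : nat, (1 <= j <= 'C(k.+1, 2) - 1)%N -> s (P - j)%N = 0) /\
  (forall i : nat, (i <= P - 'C(k.+1, 2))%N ->
     s i = (-1) ^+ k.+1 * s (P - 'C(k.+1, 2) - i)%N).
Proof.
move=> N P s.
have N1 : (1 < N)%N by rewrite -(exp1n e) ltn_exp2r // prime_gt1.
have [[P0 perP] _] := min_period_is_min N1 k_ge1; rewrite -/P in P0 perP.
have FE : qpoch 'Z_N k * pgf 'Z_N k P = 1 - 'X^P.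
  by apply: period_qpoch => // m; apply/eqP; rewrite eq_natr_Zp // perP.
have C0 : (0 < 'C(k.+1, 2))%N by rewrite bin_gt0.
have [leCP szF] := size_cofactor P0 FE.
have sE a : (a < P)%N -> s a = (pgf 'Z_N k P)`_a.
  move=> lt_aP; rewrite /s coef_gaussian ?coef_poly ?lt_aP //.
  exact: leq_trans (ltnW lt_aP) (ltnW n_gt).
split=> [j j_bd|i i_le].
  (* [j >= 1] puts the index below [P], and [j < 'C(k.+1, 2)] puts it above the degree
     [P - 'C(k.+1, 2)]. *)
  by rewrite sE ?nth_default ?szF //; lia.
rewrite !sE; [|lia..].
have revF : revp (P - 'C(k.+1, 2)) (pgf 'Z_N k P) = (-1) ^+ k.+1 * pgf 'Z_N k P.
  by apply: revp_cofactor; [rewrite szF | rewrite subnK].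
have /(congr1 (fun q : {poly 'Z_N} => q`_(P - 'C(k.+1, 2) - i))) := revF.
rewrite coef_revp leq_subr subKn // => ->.
by rewrite -polyC1 -polyCN -polyC_exp coefCM.
Qed.
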